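(* Irrespective of which $\mathsf{V} \in \{\mathsf{SS}, \mathsf{TT}, \mathsf{ST}, \mathsf{TS}, \mathsf{SS}\cap\mathsf{TT}\}$ is chosen for validity, the logic $\models_{\mathsf{DF}/\mathsf{V}}$ determined by the de Finetti conditional $f_{\to_{\mathsf{DF}}}$ on $\mathcal{L}_{\to}$ must either (1) fail Modus Ponens (the schema $A, A \to B \models_{\mathsf{DF}/\mathsf{V}} B$); or (2) fail the Identity Law (the schema $\models_{\mathsf{DF}/\mathsf{V}} A \to A$) (and other sentential validities); or (3) validate the inference from a conditional to its converse ($A \to B \models_{\mathsf{DF}/\mathsf{V}} B \to A$ for all formulae $A, B$).
   Context: Let $\mathcal{L}_{\to}$ be the propositional language with denumerably many propositional variables $p_0, p_1, \dots$ and connectives $\neg$, $\wedge$, $\to$ ($\vee$ and $\supset$ are defined from $\neg,\wedge$ as usual), and let $\mathsf{For}$ be its set of formulae. Truth values are $1$, $\tfrac12$, $0$. Negation and conjunction are Strong Kleene: $f_\neg(x) = 1-x$, $f_\wedge(x,y)=\min(x,y)$. The de Finetti conditional $f_{\to_{\mathsf{DF}}}(x,y)$ (first argument: antecedent; second: consequent) equals $y$ if $x=1$, and $\tfrac12$ if $x \in \{\tfrac12, 0\}$. A $\mathsf{DF}$-evaluation is a function $v:\mathsf{For}\to\{1,\tfrac12,0\}$ interpreting $\neg,\wedge,\to$ by $f_\neg, f_\wedge, f_{\to_{\mathsf{DF}}}$ (with arbitrary values on the propositional variables). A formula $A$ is $\mathsf{S}$-true under $v$ if $v(A)=1$, and $\mathsf{T}$-true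 under $v$ if $v(A)>0$. For $\mathsf{P},\mathsf{Q}\in\{\mathsf{S},\mathsf{T}\}$, $\Gamma\models_{\mathsf{DF}/\mathsf{PQ}} A$ means: every $\mathsf{DF}$-evaluation that makes all formulae of $\Gamma$ $\mathsf{P}$-true makes $A$ $\mathsf{Q}$-true. $\Gamma\models_{\mathsf{DF}/(\mathsf{SS}\cap\mathsf{TT})}A$ means that both $\Gamma\models_{\mathsf{DF}/\mathsf{SS}}A$ and $\Gamma\models_{\mathsf{DF}/\mathsf{TT}}A$. Here $\models A$ abbreviates $\emptyset\models A$; a sentential validity is a formula (or schema) $A$ with $\models A$. A logic fails a schema if some instance of the schema does not hold in it. *)

(* Defs.v *)
From Stdlib Require Import QArith Qminmax Ensembles.

Inductive form : Type :=
  | Var : nat -> form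
  | Neg : form -> form
  | And : form -> form -> form
  | Imp : form -> form -> form.

Inductive tval : Type := One | Half | Zero.

Definition num (x : tval) : Q :=
  match x with One => 1 | Half => 1 # 2 | Zero => 0 end.

(* Strong Kleene tables; [num_f_neg] and [num_f_and] below are the numerical
   descriptions 1 - x and min(x, y). *)
Definition f_neg (x : tval) : tval :=
  match x with One => Zero | Half => Half | Zero => One end.

Definition f_and (x y : tval) : tval :=
  match x, y with
  | Zero, _ | _, Zero => Zero
  | Half, _ | _, Half => Half
  | One, One => One
  end.

Lemma num_f_neg (x : tval) : num (f_neg x) == 1 - num x.
Proof. destruct x; reflexivity. Qed.

Lemma num_f_and (x y : tval) : num (f_and x y) == Qmin (num x) (num y).
Proof. destruct x, y; reflexivity. Qed.

Definition f_imp_DF (x y : tval) : tval :=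
  match x with One => y | Half | Zero => Half end.

Definition DF_evaluation (v : form -> tval) : Prop :=
  (forall A, v (Neg A) = f_neg (v A)) /\
  (forall A B, v (And A B) = f_and (v A) (v B)) /\
  (forall A B, v (Imp A B) = f_imp_DF (v A) (v B)).

Inductive truth_kind : Type := S_truth | T_truth.

Definition true_under (P : truth_kind) (v : form -> tval) (A : form) : Prop :=
  match P with
  | S_truth => num (v A) == 1
  | T_truth => 0 < num (v A)
  end.

Definition models_DF_PQ (P Q : truth_kind) (Gamma : Ensemble form) (A : form)
  : Prop :=
  forall v, DF_evaluation v ->
    (forall B, In form Gamma B -> true_under P v B) -> true_under Q v A.

Inductive validity : Type := SS | TT | ST | TS | SS_cap_TT.

Definition models_DF (V : validity) (Gamma : Ensemble form) (A : form) : Prop :=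
  match V with
  | SS => models_DF_PQ S_truth S_truth Gamma A
  | TT => models_DF_PQ T_truth T_truth Gamma A
  | ST => models_DF_PQ S_truth T_truth Gamma A
  | TS => models_DF_PQ T_truth S_truth Gamma A
  | SS_cap_TT => models_DF_PQ S_truth S_truth Gamma A /\
                 models_DF_PQ T_truth T_truth Gamma A
  end.

Definition sentential_validity (V : validity) (A : form) : Prop :=
  models_DF V (Empty_set form) A.

(* A schema fails when at least one of its instances does not hold. *)
Definition fails_modus_ponens (V : validity) : Prop :=
  exists A B, ~ models_DF V (Couple form A (Imp A B)) B.

Definition fails_identity_law (V : validity) : Prop :=
  exists A, ~ sentential_validity V (Imp A A).

(* No formula is valid, so that every schema which is valid according to some
   other standard fails. *)
Definition fails_sentential_validities (V : validity) : Prop :=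
  forall A, ~ sentential_validity V A.

Definition validates_conversion (V : validity) : Prop :=
  forall A B, models_DF V (Singleton form (Imp A B)) (Imp B A).

(* Main.v *)
(** The constantly [Half] function is an evaluation, so no formula is valid when
    conclusions must be S-true. For TT, an antecedent of value [Half] and a
    consequent of value [Zero] refute Modus Ponens. For ST, a conditional has
    value [One] only when both its sides do, and then so does its converse. *)
Require Import Defs.
From Stdlib Require Import QArith Ensembles.

Fixpoint eval (s : nat -> tval) (A : form) : tval :=
  match A with
  | Var n => s n
  | Neg A => f_neg (eval s A)
  | And A B => f_and (eval s A) (eval s B)
  | Imp A B => f_imp_DF (eval s A) (eval s B)
  end.

Lemma eval_DF_evaluation (s : nat -> tval) : DF_evaluation (eval s).
Proof. repeat split. Qed.

Lemma const_Half_DF_evaluation : DF_evaluation (fun _ => Half).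
Proof. repeat split. Qed.

(** With no premises to check, one argument covers both values of [P], hence SS and TS together. *)
Lemma no_S_true_validity (P : truth_kind) (A : form) :
  ~ models_DF_PQ P S_truth (Empty_set form) A.
Proof.
  intros H.
  specialize (H _ const_Half_DF_evaluation (fun B HB => match HB with end)).
  discriminate H.
Qed.

Lemma fails_of_no_validity (V : validity) :
  fails_sentential_validities V ->
  fails_identity_law V /\ fails_sentential_validities V.
Proof.
  intros H; split; [exists (Var 0); apply H | exact H].
Qed.

Lemma TT_fails_modus_ponens : fails_modus_ponens TT.
Proof.
  exists (Var 0), (Var 1); intros H.
  set (s := fun n => match n with O => Half | _ => Zero end).
  specialize (H (eval s) (eval_DF_evaluation s)).
  assert (HB : true_under T_truth (eval s) (Var 1)).
  (* [Var 0] has value [Half], and so has the conditional, since its antecedent does: both are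
     T-true. *)
  { apply H; intros B HB; destruct HB; reflexivity. }
  discriminate HB.
Qed.

Lemma ST_validates_conversion : validates_conversion ST.
Proof.
  intros A B v Hv HAB.
  specialize (HAB _ (In_singleton _ _)).
  destruct Hv as [_ [_ Himp]].
  unfold true_under in *; rewrite Himp in *.
  (* The converse is [Zero] only when [v A = Zero] and [v B = One]; there the premise is [Half], not
     S-true. *)
  destruct (v A), (v B); first [reflexivity | discriminate HAB].
Qed.

Theorem fact3p4 (V : validity) :
  fails_modus_ponens V \/
  (fails_identity_law V /\ fails_sentential_validities V) \/
  validates_conversion V.
Proof.
  destruct V.
  - right; left; apply fails_of_no_validity; intros A.
    apply no_S_true_validity.
  - left; apply TT_fails_modus_ponens.
  - right; right; apply ST_validates_conversion.
  - right; left; apply fails_of_no_validity; intros A.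
    apply no_S_true_validity.
  - right; left; apply fails_of_no_validity; intros A [HSS _].
    (* The SS half alone already excludes every formula. *)
    exact (no_S_true_validity _ _ HSS).
Qed.
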